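(* Let $n\in\mathbb{N}$ and $k>\sqrt{2n}$. The Hermitian structure $(J,\langle\cdot,\cdot\rangle)$ on $\mathfrak{n}_{\mathcal{G}_n}$ described in the context (depending on $k$) is SKT.
   Context: The Lie algebra $\mathfrak{n}_{\mathcal{G}_n}$ is the real $2$-step nilpotent Lie algebra of dimension $10n+4$ with basis $\{v_0,v_1,v_2,t_0\}\cup\{x_j,y_j,z_j,w_j,a_j,b_j,f_j,g_j,h_j,k_j\mid 1\le j\le n\}$ and whose only nonzero Lie brackets among basis elements (up to antisymmetry) are, for $1\le j\le n$: $$[v_1,v_2]=t_0,\quad [x_j,y_j]=a_j,\quad [z_j,w_j]=b_j,\quad [v_1,x_j]=f_j,\quad [v_1,y_j]=g_j,\quad [v_2,z_j]=h_j,\quad [v_2,w_j]=k_j.$$ (It is the Lie algebra of the graph $\mathcal{G}_n$ with vertices $v_0,v_1,v_2,x_j,y_j,z_j,w_j$ and edges $t_0=\overline{v_1v_2}$, $a_j=\overline{x_jy_j}$, $b_j=\overline{z_jw_j}$, $f_j=\overline{v_1x_j}$, $g_j=\overline{v_1y_j}$, $h_j=\overline{v_2z_j}$, $k_j=\overline{v_2w_j}$.) The complex structure $J$ is given by $J^2=-\mathrm{Id}$ and $$Jv_0=t_0,\quad Jv_1=v_2,\quad Jx_j=y_j,\quad Jz_j=w_j,\quad Ja_j=b_j,\quad Jf_j=g_j,\quad Jh_j=k_j\qquad(1\le j\le n).$$ For a real number $k>0$, the symmetric bilinear form $\langle\cdot,\cdot\rangle$ is defined by: - $\{v_1,v_2\}\cup\{x_j,y_j,z_j,w_j,f_j,g_j,h_j,k_j\}_{1\le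 j\le n}$ is an orthonormal set; - $\{v_0,t_0\}\cup\{a_j,b_j\}_{1\le j\le n}$ is orthogonal to the previous set; - $\langle t_0,a_j\rangle=-\langle v_0,b_j\rangle=1$ and $\langle t_0,b_j\rangle=\langle v_0,a_j\rangle=1$ for all $j$; - $\langle t_0,t_0\rangle=\langle v_0,v_0\rangle=\langle a_j,a_j\rangle=\langle b_j,b_j\rangle=k$ for all $j$; - $\langle v_0,t_0\rangle=0$, $\langle a_i,a_j\rangle=\langle b_i,b_j\rangle=0$ for $i\ne j$, and $\langle a_i,b_j\rangle=0$ for all $i,j$. For $k>\sqrt{2n}$ this form is positive definite, and $(J,\langle\cdot,\cdot\rangle)$ is a Hermitian structure, i.e. $J$ satisfies $[x,y]+J([Jx,y]+[x,Jy])-[Jx,Jy]=0$ and $\langle Jx,Jy\rangle=\langle x,y\rangle$ for all $x,y$. The Bismut torsion $3$-form of a Hermitian structure $(J,\langle\cdot,\cdot\rangle)$ on a Lie algebra is $$c(x,y,z)=-\langle[Jx,Jy],z\rangle-\langle[Jy,Jz],x\rangle-\langle[Jz,Jx],y\rangle,$$ and the Hermitian structure is SKT (strong Kähler with torsion) if $dc=0$, where $d$ is the Chevalley–Eilenberg differential. *)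

(* Defs.v *)
From HB Require Import structures.
From mathcomp Require Import all_boot all_order all_algebra.
From mathcomp Require Import reals.

Set Implicit Arguments.
Unset Strict Implicit.
Unset Printing Implicit Defensive.
Import Order.TTheory GRing.Theory Num.Theory.
Local Open Scope ring_scope.

Section HermitianStructures.
Variables (R : realType) (V : lmodType R).
Implicit Types (br : V -> V -> V) (J : V -> V) (g : V -> V -> R).
Implicit Types (x y z w : V).

Record lie_bracket br : Prop := LieBracket {
  lie_linearl : forall y, linear (br^~ y);
  lie_linearr : forall x, linear (br x);
  lie_alternating : forall x, br x x = 0;
  lie_jacobi : forall x y z, br x (br y z) + br y (br z x) + br z (br x y) = 0
}.

Record complex_structure br J : Prop := ComplexStructure {
  cplx_linear : linear J;
  cplx_square : forall x, J (J x) = - x;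
  cplx_integrable : forall x y,
    br x y + J (br (J x) y + br x (J y)) - br (J x) (J y) = 0
}.

Record inner_product g : Prop := InnerProduct {
  ip_linear : forall x, scalar (g x);
  ip_sym : forall x y, g x y = g y x;
  ip_pos : forall x, x != 0 -> 0 < g x x
}.

Record hermitian_structure br J g : Prop := HermitianStructure {
  herm_complex : complex_structure br J;
  herm_inner : inner_product g;
  herm_compat : forall x y, g (J x) (J y) = g x y
}.

Definition bismut_torsion br J g x y z : R :=
  - g (br (J x) (J y)) z - g (br (J y) (J z)) x - g (br (J z) (J x)) y.

(* The Chevalley-Eilenberg differential in degree 3, without normalization
   factor: (dc)(x_0,...,x_3) is the sum over i < j of
   (-1)^(i+j) c([x_i,x_j], ..., omit x_i, ..., omit x_j, ...).              *)
Definition ce_diff3 br (c : V -> V -> V -> R) x y z w : R :=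
  - c (br x y) z w + c (br x z) y w - c (br x w) y z
  - c (br y z) x w + c (br y w) x z - c (br z w) x y.

Record SKT br J g : Prop := Skt {
  skt_lie : lie_bracket br;
  skt_hermitian : hermitian_structure br J g;
  skt_closed : forall x y z w, ce_diff3 br (bismut_torsion br J g) x y z w = 0
}.

End HermitianStructures.

Inductive gbasis (n : nat) : Type :=
  | Bv0 | Bv1 | Bv2 | Bt0
  | Bx of 'I_n | By of 'I_n | Bz of 'I_n | Bw of 'I_n
  | Ba of 'I_n | Bb of 'I_n | Bf of 'I_n | Bg of 'I_n | Bh of 'I_n | Bk of 'I_n.
Arguments Bv0 {n}.
Arguments Bv1 {n}.
Arguments Bv2 {n}.
Arguments Bt0 {n}.

Section GbasisFinite.
Variable n : nat.

Definition gbasis_sum : finType :=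
  (bool * bool + ('I_n + ('I_n + ('I_n + ('I_n + ('I_n
   + ('I_n + ('I_n + ('I_n + ('I_n + ('I_n)))))))))))%type.

Definition gbasis_code (p : gbasis n) : gbasis_sum :=
  match p with
  | Bv0 => inl (false, false)
  | Bv1 => inl (false, true)
  | Bv2 => inl (true, false)
  | Bt0 => inl (true, true)
  | Bx j => inr (inl j)
  | By j => inr (inr (inl j))
  | Bz j => inr (inr (inr (inl j)))
  | Bw j => inr (inr (inr (inr (inl j))))
  | Ba j => inr (inr (inr (inr (inr (inl j)))))
  | Bb j => inr (inr (inr (inr (inr (inr (inl j))))))
  | Bf j => inr (inr (inr (inr (inr (inr (inr (inl j)))))))
  | Bg j => inr (inr (inr (inr (inr (inr (inr (inr (inl j))))))))
  | Bh j => inr (inr (inr (inr (inr (inr (inr (inr (inr (inl j)))))))))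
  | Bk j => inr (inr (inr (inr (inr (inr (inr (inr (inr (inr j)))))))))
  end.

Definition gbasis_decode (c : gbasis_sum) : gbasis n :=
  match c with
  | inl (false, false) => Bv0
  | inl (false, true) => Bv1
  | inl (true, false) => Bv2
  | inl (true, true) => Bt0
  | inr (inl j) => Bx j
  | inr (inr (inl j)) => By j
  | inr (inr (inr (inl j))) => Bz j
  | inr (inr (inr (inr (inl j)))) => Bw j
  | inr (inr (inr (inr (inr (inl j))))) => Ba j
  | inr (inr (inr (inr (inr (inr (inl j)))))) => Bb j
  | inr (inr (inr (inr (inr (inr (inr (inl j))))))) => Bf j
  | inr (inr (inr (inr (inr (inr (inr (inr (inl j)))))))) => Bg j
  | inr (inr (inr (inr (inr (inr (inr (inr (inr (inl j))))))))) => Bh j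
  | inr (inr (inr (inr (inr (inr (inr (inr (inr (inr j))))))))) => Bk j
  end.

Lemma gbasis_codeK : cancel gbasis_code gbasis_decode.
Proof. by case. Qed.

Lemma gbasis_decodeK : cancel gbasis_decode gbasis_code.
Proof. by case=> [[[] []]|]; do 9?[case=> //]. Qed.

HB.instance Definition _ := Finite.copy (gbasis n) (can_type gbasis_codeK).

Lemma card_gbasis : #|{: gbasis n}| = (10 * n + 4)%N.
Proof.
rewrite (bij_eq_card (Bijective gbasis_codeK gbasis_decodeK)).
rewrite !(card_sum, card_prod, card_bool, card_ord) addnC; congr addn.
by rewrite !mulSn mul0n addn0.
Qed.

End GbasisFinite.

Section GraphLieAlgebra.
Variables (R : realType) (n : nat).
Local Notation nG := {ffun gbasis n -> R^o}.

Definition gvec (p : gbasis n) : nG := [ffun q => (q == p)%:R].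

Definition gedge (p q : gbasis n) : option (gbasis n) :=
  match p, q with
  | Bv1, Bv2 => Some Bt0
  | Bx i, By j => if i == j then Some (Ba j) else None
  | Bz i, Bw j => if i == j then Some (Bb j) else None
  | Bv1, Bx j => Some (Bf j)
  | Bv1, By j => Some (Bg j)
  | Bv2, Bz j => Some (Bh j)
  | Bv2, Bw j => Some (Bk j)
  | _, _ => None
  end.

Definition gbracket_basis (p q : gbasis n) : nG :=
  if gedge p q is Some e then gvec e
  else if gedge q p is Some e then - gvec e
  else 0.

Definition gbracket (u v : nG) : nG :=
  \sum_p \sum_q (u p * v q) *: gbracket_basis p q.

Definition gJ_basis (p : gbasis n) : nG :=
  match p with
  | Bv0 => gvec Bt0       | Bt0 => - gvec Bv0
  | Bv1 => gvec Bv2       | Bv2 => - gvec Bv1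
  | Bx j => gvec (By j)   | By j => - gvec (Bx j)
  | Bz j => gvec (Bw j)   | Bw j => - gvec (Bz j)
  | Ba j => gvec (Bb j)   | Bb j => - gvec (Ba j)
  | Bf j => gvec (Bg j)   | Bg j => - gvec (Bf j)
  | Bh j => gvec (Bk j)   | Bk j => - gvec (Bh j)
  end.

Definition gJ (u : nG) : nG := \sum_p u p *: gJ_basis p.

(* The last case yields both the orthonormality of the v_1, v_2, x_j, y_j,
   z_j, w_j, f_j, g_j, h_j, k_j and the vanishing of all the remaining
   products, such as <v_0, t_0> and <a_i, b_j>.                             *)
Definition gmetric_basis (k : R) (p q : gbasis n) : R :=
  match p, q with
  | Bv0, Bv0 | Bt0, Bt0 => k
  | Ba i, Ba j | Bb i, Bb j => if i == j then k else 0
  | Bt0, Ba _ | Ba _, Bt0 => 1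
  | Bv0, Bb _ | Bb _, Bv0 => - 1
  | Bt0, Bb _ | Bb _, Bt0 => 1
  | Bv0, Ba _ | Ba _, Bv0 => 1
  | _, _ => (p == q)%:R
  end.

Definition gmetric (k : R) (u v : nG) : R :=
  \sum_p \sum_q u p * v q * gmetric_basis k p q.

Lemma sum_gvec (p : gbasis n) (S : lmodType R) (f : gbasis n -> S) :
  \sum_q (gvec p q : R) *: f q = f p.
Proof.
rewrite (bigD1 p) //= ffunE eqxx scale1r big1 ?addr0 // => q /negPf qp.
by rewrite ffunE qp scale0r.
Qed.

Lemma gbracket_gvec p q : gbracket (gvec p) (gvec q) = gbracket_basis p q.
Proof.
rewrite /gbracket -[RHS](sum_gvec p (gbracket_basis^~ q)).
apply: eq_bigr => p' _; rewrite -[in RHS](sum_gvec q (gbracket_basis p')).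
by rewrite scaler_sumr; apply: eq_bigr => q' _; rewrite scalerA.
Qed.

Lemma gJ_gvec p : gJ (gvec p) = gJ_basis p.
Proof. exact: sum_gvec. Qed.

Lemma gmetric_gvec k p q :
  gmetric k (gvec p) (gvec q) = gmetric_basis k p q.
Proof.
rewrite /gmetric -[RHS](sum_gvec p (gmetric_basis k ^~ q : _ -> R^o)).
apply: eq_bigr => p' _.
rewrite -[in RHS](sum_gvec q (gmetric_basis k p' : _ -> R^o)).
by rewrite scaler_sumr; apply: eq_bigr => q' _; rewrite scalerA.
Qed.

End GraphLieAlgebra.

(* Main.v *)
(* Everything is written in coordinates, where the metric is the sum of a part
   involving only v_0, v_1, v_2, t_0 and of one part for each block j.  As
   [g, g] and J [g, g] are central, dc(x, y, z, w) is an alternating sum of the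
   six products <[Jz, Jw], [x, y]>.  Expressed through 2 x 2 minors, it vanishes
   separately on the core and on each block: in a block, the orthonormal edges
   f, g, h, k cancel the cross products <t_0, a_j> = <t_0, b_j> = 1 by Pluecker
   relations.  Positivity comes from completing the squares in the a_j, b_j,
   which leaves (k - 2n/k)(v_0^2 + t_0^2). *)
Require Import Defs.
From mathcomp Require Import all_boot all_order all_algebra.
From mathcomp Require Import reals.
From mathcomp Require Import ring lra.
Import Order.TTheory GRing.Theory Num.Theory.
Local Open Scope ring_scope.

(** For a fixed bracket and [J], [dc] is additive in the form [g]; closedness can thus be tested on
    summands that are not inner products themselves. *)
Lemma ce_diff3_bismut_torsion_sum (R : realType) (V : lmodType R)
    (br : V -> V -> V) (J : V -> V) (g g0 : V -> V -> R) (n : nat)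
    (G : 'I_n -> V -> V -> R) (x y z w : V) :
  (forall u v, g u v = g0 u v + \sum_j G j u v) ->
  ce_diff3 br (bismut_torsion br J g) x y z w
  = ce_diff3 br (bismut_torsion br J g0) x y z w
    + \sum_j ce_diff3 br (bismut_torsion br J (G j)) x y z w.
Proof.
move=> gE; rewrite /ce_diff3 /bismut_torsion !gE.
rewrite !(sumrB, big_split, sumrN) /=; ring.
Qed.
Arguments ce_diff3_bismut_torsion_sum {R V br J g g0 n G x y z w}.

(** * Coordinates of the bracket and of the complex structure *)

Section Coordinates.
Variables (R : realType) (n : nat).
Local Notation nG := {ffun gbasis n -> R^o}.

Lemma sum_gbasis (F : gbasis n -> R) :
  \sum_p F p = F Bv0 + F Bv1 + F Bv2 + F Bt0
    + \sum_j (F (Bx j) + F (By j) + F (Bz j) + F (Bw j) + F (Ba j)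
              + F (Bb j) + F (Bf j) + F (Bg j) + F (Bh j) + F (Bk j)).
Proof.
rewrite (reindex (@gbasis_decode n)) /=; last first.
  by exists (@gbasis_code n) => p _; rewrite ?gbasis_codeK ?gbasis_decodeK.
rewrite !big_sumType /= !big_split /= -!addrA.
suff -> : \sum_(i : bool * bool) F (gbasis_decode (inl i))
   = F Bv0 + F Bv1 + F Bv2 + F Bt0 by rewrite -!addrA.
transitivity (\sum_(a : bool) \sum_(b : bool) F (gbasis_decode (inl (a, b)))).
  by rewrite pair_bigA; apply: eq_bigr => -[].
rewrite !big_bool /=; ring.
Qed.

(** Partial inverse of [gedge]: each basis element is the bracket of at most one ordered pair, so
    each coordinate of a bracket is a single 2 x 2 minor or zero. *)
Definition edge_ends (e : gbasis n) : option (gbasis n * gbasis n) :=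
  match e with
  | Bt0 => Some (Bv1, Bv2)
  | Ba j => Some (Bx j, By j)
  | Bb j => Some (Bz j, Bw j)
  | Bf j => Some (Bv1, Bx j)
  | Bg j => Some (Bv1, By j)
  | Bh j => Some (Bv2, Bz j)
  | Bk j => Some (Bv2, Bw j)
  | _ => None
  end.

Lemma gedge_ends p q e : (gedge p q == Some e) = (edge_ends e == Some (p, q)).
Proof.
apply/eqP/eqP.
- by case: p => [||||i|i|i|i|i|i|i|i|i|i];
  case: q => [||||j|j|j|j|j|j|j|j|j|j] //=;
  try (case: eqP => // ->); try (case=> <-).
- by case: e => [||||j|j|j|j|j|j|j|j|j|j] //=; case=> <- <- /=; rewrite ?eqxx.
Qed.

Lemma gedge_asym (p q d : gbasis n) : gedge p q = Some d -> gedge q p = None.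
Proof.
by case: p => [||||i|i|i|i|i|i|i|i|i|i];
  case: q => [||||j|j|j|j|j|j|j|j|j|j].
Qed.
Arguments gedge_asym {p q d}.

Lemma gbracket_basisE p q e :
  gbracket_basis R p q e
  = (edge_ends e == Some (p, q))%:R - (edge_ends e == Some (q, p))%:R.
Proof.
rewrite -!gedge_ends /gbracket_basis.
case pq: (gedge p q) => [d|].
  by rewrite (gedge_asym pq) ffunE subr0 eq_sym.
case: (gedge q p) => [d|]; rewrite !ffunE /= ?sub0r ?subr0 ?oppr0 //.
by rewrite eq_sym.
Qed.

Lemma sum_pair_delta (u v : gbasis n -> R) a b :
  \sum_p \sum_q u p * v q * (Some (a, b) == Some (p, q))%:R = u a * v b.
Proof.
rewrite (bigD1 a) //= (bigD1 b) //= eqxx mulr1 !big1 ?addr0 //.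
- move=> p pa; rewrite big1 // => q _.
  by rewrite -[_ == _]/((a == p) && _) eq_sym (negPf pa) mulr0.
- move=> q qb; rewrite -[_ == _]/((a == a) && (b == q)).
  by rewrite [b == q]eq_sym (negPf qb) andbF mulr0.
Qed.

Lemma gbracketE (u v : nG) e :
  gbracket u v e =
  if edge_ends e is Some (a, b) then u a * v b - u b * v a else 0.
Proof.
rewrite /gbracket sum_ffunE.
transitivity (\sum_p \sum_q u p * v q * (edge_ends e == Some (p, q))%:R
  - \sum_p \sum_q v p * u q * (edge_ends e == Some (p, q))%:R : R).
  (* After the exchange the subtracted sum carries the reversed pair [(q, p)], as in
     [gbracket_basisE]. *)
  rewrite [X in _ = _ - X]exchange_big /= -sumrB; apply: eq_bigr => p _.
  rewrite sum_ffunE -sumrB; apply: eq_bigr => q _.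
  by rewrite ffunE gbracket_basisE /GRing.scale /=; ring.
case: (edge_ends e) => [[a b]|].
  by rewrite !sum_pair_delta; ring.
by rewrite !big1 ?subr0 // => p _; rewrite big1 // => q _; rewrite mulr0.
Qed.

Definition gJ_coord (u : nG) (e : gbasis n) : R :=
  match e with
  | Bv0 => - u Bt0    | Bt0 => u Bv0
  | Bv1 => - u Bv2    | Bv2 => u Bv1
  | Bx j => - u (By j) | By j => u (Bx j)
  | Bz j => - u (Bw j) | Bw j => u (Bz j)
  | Ba j => - u (Bb j) | Bb j => u (Ba j)
  | Bf j => - u (Bg j) | Bg j => u (Bf j)
  | Bh j => - u (Bk j) | Bk j => u (Bh j)
  end.

Lemma gJE (u : nG) e : gJ u e = gJ_coord u e.
Proof.
(* [s] is [J] on basis elements with the signs dropped; the coordinate [e] of [gJ u] receives only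
   the term indexed by [s e]. *)
pose s (e : gbasis n) : gbasis n := match e with
  | Bv0 => Bt0    | Bt0 => Bv0
  | Bv1 => Bv2    | Bv2 => Bv1
  | Bx j => By j  | By j => Bx j
  | Bz j => Bw j  | Bw j => Bz j
  | Ba j => Bb j  | Bb j => Ba j
  | Bf j => Bg j  | Bg j => Bf j
  | Bh j => Bk j  | Bk j => Bh j
  end.
have sK : involutive s by case.
rewrite /gJ sum_ffunE (bigD1 (s e)) //= big1 => [|p pe].
  by case: e => *; rewrite /= !ffunE eqxx /GRing.scale /=; ring.
have /negPf ep : e != s p by rewrite -(inj_eq (inv_inj sK)) sK eq_sym.
by case: p ep {pe} => [||||j|j|j|j|j|j|j|j|j|j] ep;
  rewrite /= !ffunE ep ?oppr0 scaler0.
Qed.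

(** * Splitting of the metric into a core and blocks *)

Lemma sumr_delta (F : 'I_n -> R) c j :
  \sum_i F i * (if j == i then c else 0) = F j * c.
Proof.
rewrite (bigD1 j) //= eqxx big1 ?addr0 // => i.
by rewrite eq_sym => /negPf->; rewrite mulr0.
Qed.

Lemma sumr_delta_inj (c : 'I_n -> gbasis n) (F : 'I_n -> R) j :
  injective c -> \sum_i F i * (c j == c i)%:R = F j.
Proof.
move=> cI; rewrite -[RHS]mulr1 -sumr_delta; apply: eq_bigr => i _.
by rewrite (inj_eq cI); case: eqP.
Qed.
Arguments sumr_delta_inj {c F j}.

(** Coordinates of the covector [<-, v>], which turn the double sum of the metric into a single
    one. *)
Definition gmetric_dual k (v : nG) (p : gbasis n) : R :=
  match p with
  | Bv0 => k * v Bv0 + \sum_j (v (Ba j) - v (Bb j))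
  | Bt0 => k * v Bt0 + \sum_j (v (Ba j) + v (Bb j))
  | Ba j => k * v (Ba j) + v Bv0 + v Bt0
  | Bb j => k * v (Bb j) - v Bv0 + v Bt0
  | p => v p
  end.

Lemma gmetric_dualE k (v : nG) p :
  \sum_q v q * gmetric_basis k p q = gmetric_dual k v p.
Proof.
have sum0 (F : 'I_n -> R) : \sum_j F j * 0 = 0.
  by apply: big1 => j _; rewrite mulr0.
have BxI : injective (@Bx n) by move=> ? ? [].
have ByI : injective (@By n) by move=> ? ? [].
have BzI : injective (@Bz n) by move=> ? ? [].
have BwI : injective (@Bw n) by move=> ? ? [].
have BfI : injective (@Bf n) by move=> ? ? [].
have BgI : injective (@Bg n) by move=> ? ? [].
have BhI : injective (@Bh n) by move=> ? ? [].
have BkI : injective (@Bk n) by move=> ? ? [].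
rewrite sum_gbasis !big_split /=.
case: p => [||||i|i|i|i|i|i|i|i|i|i] /=.
all: rewrite !(sum0, mulr0, mulr1, addr0, add0r) ?sumr_delta ?big_split /=.
all: rewrite ?(sumr_delta_inj BxI, sumr_delta_inj ByI,
  sumr_delta_inj BzI, sumr_delta_inj BwI,
  sumr_delta_inj BfI, sumr_delta_inj BgI,
  sumr_delta_inj BhI, sumr_delta_inj BkI) -?mulr_suml ?sumrN //.
all: ring.
Qed.

Definition gmetric_core k (u v : nG) : R :=
  u Bv1 * v Bv1 + u Bv2 * v Bv2 + k * (u Bv0 * v Bv0 + u Bt0 * v Bt0).

(** The products of v_0 and t_0 with a_j and b_j go to the block, while the squares of v_0 and t_0
    stay in the core: a block is not positive by itself. *)
Definition gmetric_block k j (u v : nG) : R :=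
  u (Bx j) * v (Bx j) + u (By j) * v (By j)
  + u (Bz j) * v (Bz j) + u (Bw j) * v (Bw j)
  + u (Bf j) * v (Bf j) + u (Bg j) * v (Bg j)
  + u (Bh j) * v (Bh j) + u (Bk j) * v (Bk j)
  + k * (u (Ba j) * v (Ba j) + u (Bb j) * v (Bb j))
  + u Bt0 * (v (Ba j) + v (Bb j)) + v Bt0 * (u (Ba j) + u (Bb j))
  + u Bv0 * (v (Ba j) - v (Bb j)) + v Bv0 * (u (Ba j) - u (Bb j)).

Lemma gmetricE k (u v : nG) :
  gmetric k u v = gmetric_core k u v + \sum_j gmetric_block k j u v.
Proof.
transitivity (\sum_p u p * gmetric_dual k v p).
  apply: eq_bigr => p _; rewrite -gmetric_dualE mulr_sumr.
  by apply: eq_bigr => q _; rewrite mulrA.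
(* Only the rows of [Bv0] and [Bt0] contain sums over the blocks; these are distributed so as to
   merge with the main sum. *)
rewrite sum_gbasis /= [u Bv0 * _]mulrDr [u Bt0 * _]mulrDr !mulr_sumr.
transitivity (gmetric_core k u v +
  (\sum_j u Bv0 * (v (Ba j) - v (Bb j)) + \sum_j u Bt0 * (v (Ba j) + v (Bb j))
  + \sum_j (u (Bx j) * v (Bx j) + u (By j) * v (By j) + u (Bz j) * v (Bz j)
    + u (Bw j) * v (Bw j) + u (Ba j) * (k * v (Ba j) + v Bv0 + v Bt0)
    + u (Bb j) * (k * v (Bb j) - v Bv0 + v Bt0) + u (Bf j) * v (Bf j)
    + u (Bg j) * v (Bg j) + u (Bh j) * v (Bh j) + u (Bk j) * v (Bk j))));
  first by rewrite /gmetric_core; ring.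
rewrite -!big_split; congr (_ + _); apply: eq_bigr => j _.
by rewrite /gmetric_block /=; ring.
Qed.

(** * Closedness of the torsion form *)

(** Up to sign, [J] permutes the edges other than t_0 and sends t_0 to the isolated vertex v_0, so
    its values on brackets have no component along the end of an edge. *)
Lemma gbracket_Jbracketl (x y z : nG) : gbracket (gJ (gbracket x y)) z = 0.
Proof.
apply/ffunP=> e; rewrite gbracketE [RHS]ffunE.
by case: e => * //=; rewrite !gJE /= !gbracketE /=; ring.
Qed.

Lemma gbracket_Jbracketr (x y z : nG) : gbracket z (gJ (gbracket x y)) = 0.
Proof.
apply/ffunP=> e; rewrite gbracketE [RHS]ffunE.
by case: e => * //=; rewrite !gJE /= !gbracketE /=; ring.
Qed.

(* The commutator ideal and its image under [J] are central, so only one of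
   the three terms of [c([x, y], z, w)] survives.                           *)
Lemma bismut_torsion_gbracket (g : nG -> nG -> R) (x y z w : nG) :
  (forall v, g 0 v = 0) ->
  bismut_torsion (@gbracket R n) (@gJ R n) g (gbracket x y) z w
  = - g (gbracket (gJ z) (gJ w)) (gbracket x y).
Proof.
move=> g0; rewrite /bismut_torsion gbracket_Jbracketl gbracket_Jbracketr.
by rewrite !g0; ring.
Qed.

Definition minor (p q : gbasis n) (u v : nG) : R := u p * v q - u q * v p.

Lemma gmetric_core_gbracket k (x y z w : nG) :
  gmetric_core k (gbracket (gJ z) (gJ w)) (gbracket x y)
  = k * minor Bv1 Bv2 z w * minor Bv1 Bv2 x y.
Proof.
rewrite /gmetric_core !gbracketE /= !gJE /= -/(minor Bv1 Bv2 x y).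
by rewrite /minor; ring.
Qed.

(** [J] rotates the planes (v_1, v_2), (x_j, y_j), (z_j, w_j) and so preserves their minors; it
    turns the minors of the edges f, g, h, k, up to sign, into minors of pairs that are not
    edges. *)
Lemma gmetric_block_gbracket k j (x y z w : nG) :
  gmetric_block k j (gbracket (gJ z) (gJ w)) (gbracket x y)
  = minor Bv2 (By j) z w * minor Bv1 (Bx j) x y
    - minor Bv2 (Bx j) z w * minor Bv1 (By j) x y
    - minor Bv1 (Bw j) z w * minor Bv2 (Bz j) x y
    + minor Bv1 (Bz j) z w * minor Bv2 (Bw j) x y
    + k * (minor (Bx j) (By j) z w * minor (Bx j) (By j) x y
           + minor (Bz j) (Bw j) z w * minor (Bz j) (Bw j) x y)
    + minor Bv1 Bv2 z w * (minor (Bx j) (By j) x y + minor (Bz j) (Bw j) x y)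
    + minor Bv1 Bv2 x y * (minor (Bx j) (By j) z w + minor (Bz j) (Bw j) z w).
Proof.
rewrite /gmetric_block !gbracketE /= !gJE /= !(mul0r, add0r).
rewrite -/(minor _ _ x y).
by rewrite /minor; ring.
Qed.

(** The alternating sum is [k] times the wedge square of the decomposable 2-form given by
    [minor Bv1 Bv2], hence zero. *)
Lemma gmetric_core_closed k (x y z w : nG) :
  ce_diff3 (@gbracket R n)
    (bismut_torsion (@gbracket R n) (@gJ R n) (gmetric_core k)) x y z w = 0.
Proof.
have g0 v : gmetric_core k 0 v = 0 by rewrite /gmetric_core !ffunE; ring.
rewrite /ce_diff3 !bismut_torsion_gbracket // !gmetric_core_gbracket /minor.
ring.
Qed.

(** As 4-forms, the terms in [k] are wedge squares of decomposable forms. The edges f and g each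
    give -1 times v_1 v_2 x_j y_j (wedge of dual covectors), and <t_0, a_j> = 1, counted twice by
    symmetry, gives +2; likewise h, k and <t_0, b_j> for v_1 v_2 z_j w_j. *)
Lemma gmetric_block_closed k j (x y z w : nG) :
  ce_diff3 (@gbracket R n)
    (bismut_torsion (@gbracket R n) (@gJ R n) (gmetric_block k j)) x y z w = 0.
Proof.
have g0 v : gmetric_block k j 0 v = 0 by rewrite /gmetric_block !ffunE; ring.
rewrite /ce_diff3 !bismut_torsion_gbracket // !gmetric_block_gbracket /minor.
(* Six coordinates of each vector occur; generalizing them leaves a polynomial identity in 24
   variables and [k]. *)
move: (x Bv1) (x Bv2) (x (Bx j)) (x (By j)) (x (Bz j)) (x (Bw j)).
move: (y Bv1) (y Bv2) (y (Bx j)) (y (By j)) (y (Bz j)) (y (Bw j)).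
move: (z Bv1) (z Bv2) (z (Bx j)) (z (By j)) (z (Bz j)) (z (Bw j)).
move: (w Bv1) (w Bv2) (w (Bx j)) (w (By j)) (w (Bz j)) (w (Bw j)).
move=> *.
ring.
Qed.

End Coordinates.

(** * Positive definiteness of the metric *)

Lemma gmetric_pos (R : realType) (n : nat) (k : R)
    (hk : Num.sqrt (2 * n)%:R < k) (u : {ffun gbasis n -> R^o}) :
  u != 0 -> 0 < gmetric k u u.
Proof.
have k0 : 0 < k by apply: le_lt_trans hk; apply: sqrtr_ge0.
have kn : 0 < k - 2 * n%:R / k.
  rewrite subr_gt0 ltr_pdivrMr // -natrM.
  rewrite -[ltLHS]sqr_sqrtr ?ler0n // -expr2 ltr_pXn2r ?nnegrE ?sqrtr_ge0 //.
  exact: ltW.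
move mE: (k - _) kn => m m0.
(* The shifts complete the squares: a_j is paired with t_0 + v_0 and b_j with t_0 - v_0. *)
pose a j := u (Ba j) + (u Bt0 + u Bv0) / k.
pose b j := u (Bb j) + (u Bt0 - u Bv0) / k.
pose E := u Bv1 ^+ 2 + u Bv2 ^+ 2
  + m * (u Bv0 ^+ 2 + u Bt0 ^+ 2).
pose S j := u (Bx j) ^+ 2 + u (By j) ^+ 2 + u (Bz j) ^+ 2 + u (Bw j) ^+ 2
    + u (Bf j) ^+ 2 + u (Bg j) ^+ 2 + u (Bh j) ^+ 2 + u (Bk j) ^+ 2
    + k * (a j ^+ 2 + b j ^+ 2).
have gE : gmetric k u u = E + \sum_j S j.
  rewrite gmetricE /gmetric_core.
  (* [c] is the excess created by completing the two squares of one block; the [n] copies lower the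
     core coefficient from [k] to [m]. *)
  pose c := 2 * (u Bv0 ^+ 2 + u Bt0 ^+ 2) / k.
  have -> : \sum_j S j = \sum_j (S j - c) + n%:R * c.
    rewrite sumrB sumr_const card_ord -mulr_natl; ring.
  rewrite (eq_bigr (fun j => S j - c)); first by rewrite /E /c -mE; ring.
  by move=> j _; rewrite /gmetric_block /S /a /b /c; field; apply: lt0r_neq0.
have E0 : 0 <= E.
  by rewrite /E !addr_ge0 ?sqr_ge0 //
    mulr_ge0 ?addr_ge0 ?sqr_ge0 // ltW.
have S0 j : 0 <= S j.
  by rewrite /S !addr_ge0 ?sqr_ge0 //
    mulr_ge0 ?addr_ge0 ?sqr_ge0 // ltW.
have SS0 : 0 <= \sum_j S j by apply: sumr_ge0.
apply: contraNT; rewrite gE -leNgt => le0.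
have {le0} [Ez SSz] : E = 0 /\ \sum_j S j = 0 by split; lra.
move/eqP: Ez; rewrite /E !paddr_eq0 ?(sqr_ge0, addr_ge0, mulr_ge0, ltW m0) //.
rewrite [m * _ == 0]mulf_eq0 (gt_eqF m0) /= paddr_eq0 ?sqr_ge0 // !sqrf_eq0.
case/andP=> /andP[/eqP u1 /eqP u2] /andP[/eqP u0 /eqP ut].
have Sz j : all (fun e => u e == 0)
    [:: Bx j; By j; Bz j; Bw j; Bf j; Bg j; Bh j; Bk j; Ba j; Bb j].
  have /eqP : S j = 0 by apply: (psumr_eq0P _ SSz).
  rewrite /S !paddr_eq0 ?(sqr_ge0, addr_ge0, mulr_ge0, ltW k0) //.
  rewrite [k * _ == 0]mulf_eq0 (gt_eqF k0) /= paddr_eq0 ?sqr_ge0 // !sqrf_eq0.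
  (* Since v_0 and t_0 already vanish, the shifted [a j] and [b j] are the plain coordinates
     again. *)
  by rewrite /a /b ut u0 /= !(addr0, subr0, mul0r) andbT -!andbA.
apply/eqP/ffunP=> e; rewrite ffunE.
by case: e => [||||j|j|j|j|j|j|j|j|j|j] //; apply/eqP/(allP (Sz j));
  rewrite !inE eqxx ?orbT.
Qed.

Theorem proposition8p11 (R : realType) (n : nat) (k : R)
    (hk : Num.sqrt (2 * n)%:R < k) :
  SKT (@gbracket R n) (@gJ R n) (gmetric k).
Proof.
split.
- split.
  + move=> y a u v; apply/ffunP=> e; rewrite !(ffunE, gbracketE) /GRing.scale /=.
    by case: edge_ends => [[p q]|]; rewrite ?ffunE /GRing.scale /=; ring.
  + move=> y a u v; apply/ffunP=> e; rewrite !(ffunE, gbracketE) /GRing.scale /=.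
    by case: edge_ends => [[p q]|]; rewrite ?ffunE /GRing.scale /=; ring.
  + move=> x; apply/ffunP=> e; rewrite gbracketE ffunE.
    by case: edge_ends => [[p q]|]; ring.
  (* By 2-step nilpotency each iterated bracket vanishes: a bracket has zero coordinates at the ends
     of all edges. *)
  + move=> x y z; apply/ffunP=> e; rewrite !ffunE !gbracketE.
    case: e => * /=; rewrite ?gbracketE /=; ring.
- split.
  + split.
    * move=> a u v; apply/ffunP=> e; rewrite !(ffunE, gJE) /GRing.scale /=.
      by case: e => *; rewrite /= !ffunE /GRing.scale /=; ring.
    * move=> u; apply/ffunP=> e; rewrite !(ffunE, gJE).
      by case: e => *; rewrite /= !gJE /= ?opprK.
    * move=> u v; apply/ffunP=> e; rewrite !(ffunE, gJE, gbracketE) /=.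
      by case: e => *; rewrite /= !ffunE !gbracketE /= ?gJE /=; ring.
  + split.
    * move=> u a v w; rewrite !gmetricE /=.
      rewrite [X in _ = X + _]mulrDr mulr_sumr addrACA -big_split /=.
      rewrite /gmetric_core !ffunE /GRing.scale /=.
      congr (_ + _); first ring.
      by apply: eq_bigr => j _; rewrite /gmetric_block !ffunE /GRing.scale /=; ring.
    * move=> u v; rewrite !gmetricE /gmetric_core; congr (_ + _); first ring.
      by apply: eq_bigr => j _; rewrite /gmetric_block; ring.
    * exact: gmetric_pos.
  + move=> u v; rewrite !gmetricE /gmetric_core !gJE /=.
    congr (_ + _); first ring.
    by apply: eq_bigr => j _; rewrite /gmetric_block !gJE /=; ring.
- move=> x y z w; rewrite (ce_diff3_bismut_torsion_sum (@gmetricE R n k)).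
  rewrite gmetric_core_closed add0r; apply: big1 => j _.
  exact: gmetric_block_closed.
Qed.
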